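(* Let $n\ge1$, $d\ge2$. Every $p\in\mathbb{R}[x_0,\dots,x_n]_{(d)}$ (equivalently, every real symmetric tensor of order $d$ on $\mathbb{R}^{n+1}$) with $$\mathrm{dist}_{\mathrm{BW}}(p,\mathcal{V}_{n,d})<\sin(\rho(V_{n,d}))\,\|p\|_{\mathrm{BW}}$$ admits a unique best rank-one approximation.
   Context: Let $N+1=\binom{n+d}{d}$ and let $\mathbb{R}[x_0,\dots,x_n]_{(d)}\cong\mathbb{R}^{N+1}$ be the space of real homogeneous polynomials of degree $d$, with the Bombieri--Weyl scalar product, i.e. the one for which the polynomials $\binom{d}{\alpha}^{1/2}x^\alpha$ ($\alpha\in\mathbb{Z}_{\ge0}^{n+1}$, $\alpha_0+\dots+\alpha_n=d$, $\binom d\alpha=\frac{d!}{\alpha_0!\cdots\alpha_n!}$) form an orthonormal basis; $\|\cdot\|_{\mathrm{BW}}$ and $\mathrm{dist}_{\mathrm{BW}}$ are its norm and distance. It is identified isometrically with the space of real symmetric tensors of order $d$ on $\mathbb{R}^{n+1}$ with the Frobenius scalar product via $T\mapsto \langle T,x^{\otimes d}\rangle_F$. Rank-one symmetric tensors $\pm v^{\otimes d}$ correspond to the Veronese variety $\mathcal{V}_{n,d}=\{\pm\ell^d:\ \ell\text{ a linear form on }\mathbb{R}^{n+1}\}$. A best rank-one approximation of $p$ is a point of $\mathcal{V}_{n,d}$ realizing $\mathrm{dist}_{\mathrm{BW}}(p,\mathcal{V}_{n,d})$. $S^N$ is the unit sphere for $\|\cdot\|_{\mathrm{BW}}$ with its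 round metric, and $V_{n,d}=\mathcal{V}_{n,d}\cap S^N$, a compact smooth $n$-dimensional submanifold. For a submanifold $M$ of a Riemannian manifold $\overline M$, let $N^{\varepsilon}M$ be the set of normal vectors of norm less than $\varepsilon$; the reach is $\rho(M)=\sup\{\varepsilon\ge 0 : \exp|_{N^{\varepsilon}M}\text{ is a diffeomorphism onto its image}\}$, where $\exp$ is the exponential map of $\overline M$. Here $\rho(V_{n,d})$ is the reach of $V_{n,d}\hookrightarrow S^N$. *)

(* Defs.v *)
From HB Require Import structures.
From mathcomp Require Import all_boot all_order all_algebra.
From mathcomp Require Import all_classical all_reals all_analysis.
(* The notations of mpoly clash with those of MathComp-Analysis. *)
From mathcomp Require Import -(notations) mpoly.

Set Implicit Arguments.
Unset Strict Implicit.
Unset Printing Implicit Defensive.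

Import Order.TTheory GRing.Theory Num.Theory.
Import numFieldNormedType.Exports.

Local Open Scope classical_set_scope.
Local Open Scope ring_scope.

Section Smooth.
Context {R : realType} {V W : normedModType R}.
Implicit Types (U A : set V) (f F : V -> W).

(* Meant for [U] open and [V] finite-dimensional: a map is then C^(k+1) iff it
   is differentiable and all its directional derivatives are C^k. *)
Fixpoint class_C (k : nat) U f : Prop :=
  match k with
  | 0 => forall x, U x -> {for x, continuous f}
  | k'.+1 => (forall x, U x -> differentiable f x) /\
             forall v, class_C k' U ('D_v f)
  end.

Definition smooth_open U f : Prop := forall k, class_C k U f.

(* Smoothness on an arbitrary subset of a Euclidean space: local extendability
   to a smooth map on an open set.  On an embedded submanifold this is the usual
   notion of smoothness. *)
Definition smooth_on A f : Prop :=
  forall x, A x -> exists U F,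
    [/\ open U, U x, smooth_open U F & forall y, A y -> U y -> F y = f y].

End Smooth.

(* When [A] is an embedded submanifold this makes [f @` A] an embedded
   submanifold as well, and the corestriction of [f] a diffeomorphism. *)
Definition diffeo_onto_image {R : realType} {V W : normedModType R}
    (A : set V) (f : V -> W) : Prop :=
  exists g : W -> V,
    [/\ forall x, A x -> g (f x) = x, smooth_on A f & smooth_on (f @` A) g].

Section Reach.
Context {R : realType} {m : nat}.
Local Notation E := 'rV[R]_m.
Implicit Types (S M : set E) (x v : E) (gam : R -> E).

(* The norm [`| |] that the library puts on row vectors is the sup norm; it
   is used for the topology and the derivatives only. *)
Definition dotv (u v : E) : R := \sum_i u 0 i * v 0 i.
Definition enorm v : R := Num.sqrt (dotv v v).

Definition unit_sphere : set E := [set x | enorm x = 1].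

Definition tangent M x : set E :=
  [set v | exists (U : set R^o) gam,
     [/\ open U, U 0 & smooth_open U (gam : R^o -> E)] /\
     [/\ forall t, U t -> M (gam t), gam 0 = x & derive1 gam 0 = v]].

(* Geodesics R -> S for the metric induced on S by the Euclidean one: the
   Levi-Civita covariant derivative is the tangential part of the Euclidean
   derivative, so a curve is a geodesic iff its acceleration is normal to S. *)
Definition geodesic S gam : Prop :=
  [/\ smooth_open setT (gam : R^o -> E),
      forall t, S (gam t) &
      forall t w, tangent S (gam t) w -> dotv (derive1n 2 gam t) w = 0].

(* For a complete S, such as the sphere, the geodesic with initial velocity
   [xv.2] at [xv.1] exists and is unique; the default 0 is then never used for
   tangent vectors of S. *)
Definition riem_exp S (xv : E * E) : E :=
  xget 0 [set y | exists gam,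
    [/\ geodesic S gam, gam 0 = xv.1, derive1 gam 0 = xv.2 & gam 1 = y]].

Definition normal_tube S M (eps : R) : set (E * E) :=
  [set xv | [/\ M xv.1, tangent S xv.1 xv.2,
                forall w, tangent M xv.1 w -> dotv xv.2 w = 0 &
                enorm xv.2 < eps]].

(* Real supremum: for S the sphere and M of smaller dimension, the set is
   bounded by pi, since exp sends all normal vectors of norm pi at x to -x. *)
Definition reach S M : R :=
  sup [set eps | 0 <= eps /\
                 diffeo_onto_image (normal_tube S M eps) (riem_exp S)].

End Reach.

Section BombieriWeyl.
Context {R : realType} {n d : nat}.
Local Notation form := (dhomog n.+1 R d).
Implicit Types (p q : form).

Definition monomials : seq (multinom n.+1) :=
  [seq s2m t | t : d.-tuple 'I_n.+1 <- enum (basis n.+1 d)].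

Definition multinomial_coef (a : multinom n.+1) : R :=
  (mdeg a)`!%:R / \prod_i (a i)`!%:R.

(* Coordinates of p in the basis of the (multinomial_coef a)^(1/2) x^a. *)
Definition bw_coord p : 'rV[R]_('C(d + n, d)) :=
  \row_i (mcoeff (nth mnm0 monomials i) p
          / Num.sqrt (multinomial_coef (nth mnm0 monomials i))).

Definition bw_dot p q : R := dotv (bw_coord p) (bw_coord q).
Definition bw_norm p : R := Num.sqrt (bw_dot p p).

Lemma bw_dot_orthonormal (a b : multinom n.+1) p q :
  mdeg a = d -> mdeg b = d ->
  (p : mpoly n.+1 R) = Num.sqrt (multinomial_coef a) *: mpolyX R a ->
  (q : mpoly n.+1 R) = Num.sqrt (multinomial_coef b) *: mpolyX R b ->
  bw_dot p q = (a == b)%:R.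
Proof.
move=> da db pE qE.
have c0 c : Num.sqrt (multinomial_coef c) != 0.
  rewrite gt_eqF // sqrtr_gt0 divr_gt0 ?ltr0n ?fact_gt0 //.
  by apply: prodr_gt0 => i _; rewrite ltr0n fact_gt0.
have memb c : mdeg c = d -> c \in monomials.
  by move=> dc; rewrite -basis_cover dc.
have := memb a da; rewrite -index_mem size_basis => lt_a.
rewrite /bw_dot /dotv (bigD1 (Ordinal lt_a)) //= big1 => [|i ne_i].
  rewrite !mxE /= nth_index ?memb // pE qE !mcoeffZ !mcoeffX eqxx mulr1.
  rewrite divff // mul1r addr0 eq_sym; case: eqP => [->|_].
    by rewrite mulr1 divff.
  by rewrite mulr0 mul0r.
rewrite !mxE pE mcoeffZ mcoeffX; case: eqP => [aE|_].
  case/eqP: ne_i; apply: val_inj; rewrite /= aE index_uniq ?uniq_basis //.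
  by rewrite size_basis.
by rewrite mulr0 !mul0r.
Qed.

Definition bw_dist p (A : set form) : R :=
  inf [set bw_norm (p - q) | q in A].

Definition veronese : set form :=
  [set q | exists l : dhomog n.+1 R 1,
     (q : mpoly n.+1 R) = (l : mpoly n.+1 R) ^+ d \/
     (q : mpoly n.+1 R) = - (l : mpoly n.+1 R) ^+ d].

Definition best_rank_one p q : Prop :=
  veronese q /\ bw_norm (p - q) = bw_dist p veronese.

End BombieriWeyl.

Arguments veronese R n d : clear implicits.

(* V_{n,d} as a subset of the unit sphere of R^(N+1), N + 1 = 'C(d + n, d),
   through the isometry [bw_coord]. *)
Definition veronese_sphere (R : realType) (n d : nat)
    : set 'rV[R]_('C(d + n, d)) :=
  bw_coord @` veronese R n d `&` unit_sphere.

Arguments veronese_sphere R n d : clear implicits.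

(* Main.v *)
Require Import Defs.
From HB Require Import structures.
From mathcomp Require Import all_boot all_order all_algebra.
From mathcomp Require Import all_classical all_reals all_analysis.
From mathcomp Require Import -(notations) mpoly.
From mathcomp Require Import ring lra.

Set Implicit Arguments.
Unset Strict Implicit.
Unset Printing Implicit Defensive.

Import Order.TTheory GRing.Theory Num.Theory.
Import numFieldNormedType.Exports.

Local Open Scope classical_set_scope.
Local Open Scope ring_scope.

(* The set of forms +-l^d is closed under real scaling.  If q is a nonzero
   element nearest to p, then p - q is orthogonal to q, and q / |q| maximizes
   y |-> <p, y> over the unit elements, so (p - q) / |p - q| is normal to
   V_{n,d} at q / |q|.  The point p / |p| thus lies on the great circle leaving
   q / |q| in this normal direction, at distance t with sin t = |p - q| / |p|.
   The hypothesis forces t to be less than the reach, where the normal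
   exponential map is injective: hence q / |q|, and then q, is determined by p.
   A nearest element exists because |p -+ l^d| tends to infinity with the
   coefficients of l, the coefficients of the x_i^d in l^d being their powers. *)

(** * The Euclidean scalar product on row vectors *)

Section EuclideanProduct.
Context {R : realType} {m : nat}.
Local Notation E := 'rV[R]_m.
Implicit Types (u v w x y : E) (a : R).

Lemma dotvC u v : dotv u v = dotv v u.
Proof. by apply: eq_bigr => i _; rewrite mulrC. Qed.

Lemma dotvDr u v w : dotv u (v + w) = dotv u v + dotv u w.
Proof. by rewrite -big_split; apply: eq_bigr => i _; rewrite mxE mulrDr. Qed.

Lemma dotvZr a u v : dotv u (a *: v) = a * dotv u v.
Proof. by rewrite mulr_sumr; apply: eq_bigr => i _; rewrite mxE mulrCA. Qed.

Lemma dotvNr u v : dotv u (- v) = - dotv u v.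
Proof. by rewrite -scaleN1r dotvZr mulN1r. Qed.

Lemma dotvBr u v w : dotv u (v - w) = dotv u v - dotv u w.
Proof. by rewrite dotvDr dotvNr. Qed.

Lemma dotvDl u v w : dotv (v + w) u = dotv v u + dotv w u.
Proof. by rewrite dotvC dotvDr !(dotvC u). Qed.

Lemma dotvZl a u v : dotv (a *: v) u = a * dotv v u.
Proof. by rewrite dotvC dotvZr dotvC. Qed.

Lemma dotvNl u v : dotv (- v) u = - dotv v u.
Proof. by rewrite dotvC dotvNr dotvC. Qed.

Lemma dotvBl u v w : dotv (v - w) u = dotv v u - dotv w u.
Proof. by rewrite dotvDl dotvNl. Qed.

Definition dotvE := (dotvDr, dotvDl, dotvNr, dotvNl, dotvZr, dotvZl).

Lemma dotv0 u : dotv u 0 = 0.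
Proof. by rewrite -(scale0r 0) dotvZr mul0r. Qed.

Lemma dotv_ge0 u : 0 <= dotv u u.
Proof. by apply: sumr_ge0 => i _; rewrite -expr2 sqr_ge0. Qed.

Lemma dotv_eq0 u : (dotv u u == 0) = (u == 0).
Proof.
apply/eqP/eqP => [|->]; last by rewrite dotv0.
move/psumr_eq0P => u0; apply/rowP => i; rewrite mxE; apply/eqP.
by rewrite -sqrf_eq0 expr2 u0// => j _; rewrite -expr2 sqr_ge0.
Qed.

Lemma sqr_enorm u : enorm u ^+ 2 = dotv u u.
Proof. by rewrite sqr_sqrtr ?dotv_ge0. Qed.

Lemma enorm_ge0 u : 0 <= enorm u. Proof. exact: sqrtr_ge0. Qed.

Lemma enorm_eq0 u : (enorm u == 0) = (u == 0).
Proof. by rewrite -sqrf_eq0 sqr_enorm dotv_eq0. Qed.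

Lemma enormZ a u : enorm (a *: u) = `|a| * enorm u.
Proof.
by rewrite /enorm dotvZl dotvZr mulrA -expr2 sqrtrM ?sqr_ge0// sqrtr_sqr.
Qed.

Lemma unit_sphereE u : unit_sphere u <-> dotv u u = 1.
Proof.
rewrite -sqr_enorm; split=> [->|/eqP]; first by rewrite expr1n.
by rewrite sqrp_eq1 ?enorm_ge0// => /eqP.
Qed.

Lemma dotv_unit_sphere u v : unit_sphere u -> unit_sphere v -> dotv u v <= 1.
Proof.
move=> /unit_sphereE uu /unit_sphereE vv; have := dotv_ge0 (u - v).
by rewrite !dotvE (dotvC v u) uu vv; lra.
Qed.

Lemma coord_le_enorm u i : `|u 0 i| <= enorm u.
Proof.
rewrite -ler_sqr ?nnegrE ?enorm_ge0// sqr_enorm real_normK ?num_real//.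
rewrite /dotv (bigD1 i)//= -expr2 lerDl sumr_ge0// => j _.
by rewrite -expr2 sqr_ge0.
Qed.

End EuclideanProduct.

(** * Derivatives of curves and first-order conditions at a maximum *)

Section Curves.
Context {R : realType} {m : nat}.
Local Notation E := 'rV[R]_m.
Implicit Types (M : set E) (u v w x y : E) (f g gam : R -> E) (t : R).

Lemma is_derive_coord f t v i : is_derive t (1 : R^o) (f : R^o -> E) v ->
  is_derive t (1 : R^o) (fun s : R^o => f s 0 i) (v 0 i).
Proof.
move=> [df <-]; apply: DeriveDef; first by move/derivable_mxP : df; apply.
by rewrite derive_mx// mxE.
Qed.

Lemma is_derive_row f t v :
  (forall i, is_derive t (1 : R^o) (fun s : R^o => f s 0 i) (v 0 i)) ->
  is_derive t (1 : R^o) (f : R^o -> E) v.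
Proof.
move=> df; have fd : derivable (f : R^o -> E) t (1 : R^o).
  by apply/derivable_mxP => i j; rewrite (ord1 i); case: (df j).
apply: DeriveDef => //; rewrite derive_mx//.
by apply/rowP => i; rewrite mxE; case: (df i).
Qed.

Lemma is_derive_dotv f g t u v :
  is_derive t (1 : R^o) (f : R^o -> E) u ->
  is_derive t (1 : R^o) (g : R^o -> E) v ->
  is_derive t (1 : R^o) (fun s : R^o => dotv (f s) (g s))
    (dotv u (g t) + dotv (f t) v).
Proof.
move=> fu gv.
have := @is_derive_sum R R^o R^o m
  (fun i => (fun s : R => f s 0 i) * (fun s : R => g s 0 i)) t 1
  (fun i => f t 0 i *: (v 0 i : R^o) + g t 0 i *: (u 0 i : R^o)).
have -> : \sum_(i < m) (fun s : R => f s 0 i) * (fun s : R => g s 0 i)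
          = (fun s => dotv (f s) (g s)).
  by apply/funext => s; rewrite fct_sumE.
have -> : \sum_(i < m) (f t 0 i *: (v 0 i : R^o) + g t 0 i *: (u 0 i : R^o))
          = dotv u (g t) + dotv (f t) v.
  rewrite addrC -big_split; apply: eq_bigr => i _ /=.
  by congr (_ + _); exact: mulrC.
apply=> i; apply: is_deriveM; exact: is_derive_coord.
Qed.

(** Fermat's criterion for the scalar function [s |-> dotv a (gam s)] on the interval of radius [e]
    around [t]. *)
Lemma curve_argmax_dotv gam t v a (e : R) : 0 < e ->
  (forall s, `|s - t| < e -> derivable (gam : R^o -> E) s 1) ->
  (forall s, `|s - t| < e -> dotv a (gam s) <= dotv a (gam t)) ->
  dotv a (derive1 gam t) = 0.
Proof.
move=> e0 dgam amax.
have cst_a s : is_derive s (1 : R^o) (fun=> a : E) 0 by exact: is_derive_cst.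
have dad s : `|s - t| < e ->
    is_derive s (1 : R^o) (fun s : R^o => dotv a (gam s))
      (dotv a (derive1 gam s)).
  move=> ste; rewrite derive1E.
  have /derivableP dg := dgam _ ste.
  apply: is_derive_eq; first exact: (is_derive_dotv (cst_a s) dg).
  by rewrite dotvC dotv0 add0r.
have inI s : s \in `](t - e), (t + e)[%R -> `|s - t| < e.
  by rewrite in_itv/= ltr_norml => /andP[? ?]; apply/andP; split; lra.
have [||||_ <-] := @derive1_at_max R (fun s => dotv a (gam s)) (t - e) (t + e) t.
- lra.
- by move=> s /inI/dad[].
- by rewrite in_itv/=; apply/andP; split; lra.
- by move=> s /inI/amax.
- by have [|_ ->] := dad t; rewrite ?subrr ?normr0.
Qed.

(** A linear functional that is maximal on [M] at [x] is critical along every curve in [M] through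
    [x]. This gives both the tangent spaces of the sphere and the normality of the residual at a
    nearest point. *)
Lemma tangent_argmax_dotv M x v a : tangent M x v ->
  (forall y, M y -> dotv a y <= dotv a x) -> dotv a v = 0.
Proof.
move=> [U [gam [[oU U0 sgam] [gamM gx <-]]]] amax.
have /nbhs_ballP[e /= e0 eU] : nbhs (0 : R^o) U by exact: open_nbhs_nbhs.
have inU s : `|s - 0| < e -> U s.
  by move=> se; apply: eU; rewrite -ball_normE/= distrC.
apply: (@curve_argmax_dotv gam 0 (derive1 gam 0) a e) => // s /inU Us.
- by apply: diff_derivable; case: (sgam 1%N) => + _; exact.
- by rewrite gx; apply/amax/gamM.
Qed.

End Curves.

(** * Geodesics and the exponential map of the unit sphere *)

Section SphereGeodesics.
Context {R : realType} {m : nat}.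
Local Notation E := 'rV[R]_m.
Local Notation S := (@unit_sphere R m).
Implicit Types (u v w x y : E) (gam : R -> E) (k t : R).

(** Leaving [x] and [u] arbitrary, not orthonormal, makes the family closed under
    differentiation. *)
Definition great_circle x u k t : E := cos (k * t) *: x + sin (k * t) *: u.

Lemma great_circle0 x u k : great_circle x u k 0 = x.
Proof. by rewrite /great_circle mulr0 cos0 sin0 scale1r scale0r addr0. Qed.

Lemma is_derive_great_circle x u k t :
  is_derive t (1 : R^o) (great_circle x u k : R^o -> E)
    (great_circle (k *: u) (- k *: x) k t).
Proof.
apply: is_derive_row => i.
have dk : is_derive t (1 : R) (fun s : R => k * s) k.
  have := is_deriveZ k (is_derive_id (t : R^o) (1 : R^o)).
  by rewrite -[k *: (1 : R^o)]/(k * 1) mulr1.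
have dc : is_derive t (1 : R) (fun s : R => cos (k * s) * x 0 i)
    (- sin (k * t) * k * x 0 i).
  have -> : (fun s : R => cos (k * s) * x 0 i)
    = x 0 i \*: (cos \o (fun s : R => k * s)) :> (R -> R).
    by apply/funext => s /=; exact: mulrC.
  apply: is_derive_eq; exact: mulrC.
have ds : is_derive t (1 : R) (fun s : R => sin (k * s) * u 0 i)
    (cos (k * t) * k * u 0 i).
  have -> : (fun s : R => sin (k * s) * u 0 i)
    = u 0 i \*: (sin \o (fun s : R => k * s)) :> (R -> R).
    by apply/funext => s /=; exact: mulrC.
  apply: is_derive_eq; exact: mulrC.
have /= := is_deriveD dc ds.
rewrite (_ : _ + _ = (fun s : R^o => great_circle x u k s 0 i)); last first.
  by apply/funext => s; rewrite !mxE.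
move=> [? eD]; apply: DeriveDef => //; rewrite eD.
by rewrite !mxE; ring.
Qed.

Lemma derive1_great_circle x u k :
  derive1 (great_circle x u k) = great_circle (k *: u) (- k *: x) k.
Proof.
apply/funext => t; rewrite derive1E.
by have [_ ->] := is_derive_great_circle x u k t.
Qed.

Lemma derive_scale1 (V : normedModType R) (f : R^o -> V) (t a : R^o) :
  differentiable f t -> 'D_a f t = a *: 'D_1 f t.
Proof.
by move=> df; rewrite !deriveE// -[in LHS](mulr1 a) -[a * 1]/(a *: 1) linearZ.
Qed.

Lemma smooth_great_circle x u k U :
  smooth_open U (great_circle x u k : R^o -> E).
Proof.
(* The induction generalizes [x] and [u], because every directional derivative is a great-circle
   expression with other vectors and the same [k]. *)
move=> n; elim: n x u => [|n IHn] x u.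
  move=> t _; apply/differentiable_continuous/derivable1_diffP.
  by have [] := is_derive_great_circle x u k t.
have df t : differentiable (great_circle x u k : R^o -> E) t.
  by apply/derivable1_diffP; have [] := is_derive_great_circle x u k t.
split=> // a.
suff -> : 'D_a (great_circle x u k : R^o -> E)
  = (great_circle (a *: (k *: u)) (a *: (- k *: x)) k : R^o -> E) by exact: IHn.
apply/funext => t; rewrite derive_scale1// -derive1E derive1_great_circle.
by rewrite /great_circle scalerDr !scalerA; congr (_ *: _ + _ *: _); ring.
Qed.

(** The condition on [u] is guarded by [k != 0] so as to cover the constant curve of a zero tangent
    vector, whose normalization is not a unit vector. *)
Lemma great_circle_sphere x u k t : S x -> dotv x u = 0 ->
  (k != 0 -> S u) -> S (great_circle x u k t).
Proof.
move=> /unit_sphereE xx xu su; apply/unit_sphereE.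
rewrite /great_circle !dotvE (dotvC u x) xx xu.
have [->|/su/unit_sphereE->] := eqVneq k 0.
  by rewrite mul0r cos0 sin0 !(mul0r, mulr0, mul1r, addr0).
by rewrite !(mulr0, mulr1, addr0, add0r) -!expr2 cos2Dsin2.
Qed.

Lemma normalize_scale v : v = enorm v *: ((enorm v)^-1 *: v).
Proof.
have [/eqP|v0] := eqVneq (enorm v) 0.
  by rewrite enorm_eq0 => /eqP ->; rewrite !scaler0.
by rewrite scalerA divff// scale1r.
Qed.

Lemma normalize_sphere v : enorm v != 0 -> S ((enorm v)^-1 *: v).
Proof.
move=> v0; rewrite /unit_sphere/= enormZ ger0_norm ?invr_ge0 ?enorm_ge0//.
by rewrite mulVf.
Qed.

(** One direction holds since [x] maximizes [dotv x] on the sphere; for the other, the great circle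
    with direction [w / |w|] and speed [|w|] has initial velocity [w]. *)
Lemma tangent_sphereP x w : S x -> tangent S x w <-> dotv x w = 0.
Proof.
move=> Sx; split=> [xw|xw].
  apply: (tangent_argmax_dotv xw) => y Sy.
  by move/unit_sphereE : (Sx) => ->; exact: dotv_unit_sphere.
exists setT, (great_circle x ((enorm w)^-1 *: w) (enorm w)); split; split.
- exact: openT.
- by [].
- exact: smooth_great_circle.
- move=> t _; apply: great_circle_sphere => //; last exact: normalize_sphere.
  by rewrite dotvZr xw mulr0.
- exact: great_circle0.
- by rewrite derive1_great_circle great_circle0 -normalize_scale.
Qed.

(** The acceleration is $-k^2$ times the position, which is normal to the sphere. *)
Lemma geodesic_great_circle x u k : S x -> S u -> dotv x u = 0 ->
  geodesic S (great_circle x u k).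
Proof.
move=> Sx Su xu; have Sg t : S (great_circle x u k t).
  exact: great_circle_sphere.
split=> // [|t w /(tangent_sphereP _ (Sg t)) gw].
  exact: smooth_great_circle.
rewrite derive1nS derive1n1 !derive1_great_circle.
suff -> : great_circle (k *: (- k *: x)) (- k *: (k *: u)) k t
          = - k ^+ 2 *: great_circle x u k t by rewrite dotvZl gw mulr0.
rewrite /great_circle scalerDr !scalerA.
by congr (_ *: _ + _ *: _); ring.
Qed.

Lemma is_derive_dotv_cst (f g f' g' : R -> E) :
  (forall t, is_derive t (1 : R^o) (f : R^o -> E) (f' t)) ->
  (forall t, is_derive t (1 : R^o) (g : R^o -> E) (g' t)) ->
  (forall t, dotv (f' t) (g t) + dotv (f t) (g' t) = 0) ->
  forall t, dotv (f t) (g t) = dotv (f 0) (g 0).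
Proof.
move=> df dg d0 t.
apply: (@is_derive_0_is_cst R (fun s => dotv (f s) (g s))) => s.
by apply: is_derive_eq; [exact: is_derive_dotv|exact: d0].
Qed.

Lemma smooth_is_derive1 gam t : smooth_open setT (gam : R^o -> E) ->
  is_derive t (1 : R^o) (gam : R^o -> E) (derive1 gam t).
Proof.
move=> sg; rewrite derive1E; apply/derivableP/diff_derivable.
by case: (sg 1%N) => + _; exact.
Qed.

Lemma smooth_derive1 gam : smooth_open setT (gam : R^o -> E) ->
  smooth_open setT (derive1 gam : R^o -> E).
Proof.
move=> sg n; have [_ /(_ 1)] := sg n.+1.
by congr class_C; apply/funext => t; rewrite derive1E.
Qed.

Section Geodesic.
Variable gam : R -> E.
Hypothesis geo_gam : geodesic S gam.
Let smooth_gam : smooth_open setT (gam : R^o -> E).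
Proof. by case: geo_gam. Qed.
Let gamS t : S (gam t). Proof. by case: geo_gam. Qed.

Lemma geodesic_is_derive1 t :
  is_derive t (1 : R^o) (gam : R^o -> E) (derive1 gam t).
Proof. exact: smooth_is_derive1. Qed.

Lemma geodesic_is_derive2 t :
  is_derive t (1 : R^o) (derive1 gam : R^o -> E) (derive1n 2 gam t).
Proof. exact/smooth_is_derive1/smooth_derive1. Qed.

Lemma geodesic_dotv_derive1 t : dotv (gam t) (derive1 gam t) = 0.
Proof.
apply: (@curve_argmax_dotv _ _ gam t 0 (gam t) 1) => // s _.
  by have [] := geodesic_is_derive1 s.
by move/unit_sphereE : (gamS t) => ->; exact: dotv_unit_sphere.
Qed.

Lemma geodesic_normal t w :
  dotv (gam t) w = 0 -> dotv (derive1n 2 gam t) w = 0.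
Proof.
by case: geo_gam => _ _ + gw; apply; apply/tangent_sphereP.
Qed.

(** The derivative of $|\gamma'|^2$ is $2\langle\gamma'',\gamma'\rangle$, which vanishes because
    $\gamma'$ is tangent and $\gamma''$ normal. *)
Lemma geodesic_speed t :
  dotv (derive1 gam t) (derive1 gam t) = dotv (derive1 gam 0) (derive1 gam 0).
Proof.
apply: (is_derive_dotv_cst geodesic_is_derive2 geodesic_is_derive2) => s.
rewrite [X in _ + X]dotvC geodesic_normal ?addr0//.
exact: geodesic_dotv_derive1.
Qed.

(** Differentiate the identity $\langle\gamma,\gamma'\rangle=0$ and use that the speed is
    constant. *)
Lemma geodesic_derive2_dotv t :
  dotv (derive1n 2 gam t) (gam t) = - dotv (derive1 gam 0) (derive1 gam 0).
Proof.
have [_] := is_derive_dotv (geodesic_is_derive1 t) (geodesic_is_derive2 t).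
have -> : (fun s : R^o => dotv (gam s) (derive1 gam s)) = cst 0.
  by apply/funext => s; exact: geodesic_dotv_derive1.
rewrite derive_cst geodesic_speed => /esym/eqP.
by rewrite addrC addr_eq0 dotvC => /eqP.
Qed.

(** The vector $w=\gamma''+K\gamma$ is orthogonal to $\gamma$, hence tangent, hence orthogonal to
    $\gamma''$ as well; so $\langle w,w\rangle=0$. *)
Lemma geodesic_derive2 t :
  derive1n 2 gam t = - dotv (derive1 gam 0) (derive1 gam 0) *: gam t.
Proof.
set K := dotv _ _; apply/eqP; rewrite scaleNr -addr_eq0 -dotv_eq0.
have gw : dotv (gam t) (derive1n 2 gam t + K *: gam t) = 0.
  rewrite dotvDr dotvZr dotvC geodesic_derive2_dotv.
  by move/unit_sphereE : (gamS t) => ->; rewrite -/K mulr1 addNr.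
by rewrite dotvDl dotvZl gw geodesic_normal// mulr0 addr0.
Qed.

End Geodesic.

(* The difference z of two such geodesics solves the linear equation z'' = -K z,
   K = |gam1'(0)|^2, so its energy |z'|^2 + K |z|^2 vanishes identically; this
   kills z' even when K = 0. *)
Lemma geodesic_uniq gam1 gam2 : geodesic S gam1 -> geodesic S gam2 ->
  gam1 0 = gam2 0 -> derive1 gam1 0 = derive1 gam2 0 -> gam1 = gam2.
Proof.
move=> g1 g2 e0 e1; apply/funext => t.
pose z s := gam1 s - gam2 s; pose z' s := derive1 gam1 s - derive1 gam2 s.
set K := dotv (derive1 gam1 0) (derive1 gam1 0).
have dz s : is_derive s (1 : R^o) (z : R^o -> E) (z' s).
  by apply: is_deriveB; exact: geodesic_is_derive1.
have dz' s : is_derive s (1 : R^o) (z' : R^o -> E) (- K *: z s).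
  apply: is_derive_eq.
    by apply: is_deriveB; exact: geodesic_is_derive2.
  by rewrite !geodesic_derive2// -e1 -scalerBr.
have energy s : dotv (z' s) (z' s) + K * dotv (z s) (z s) = 0.
  have z'0 : z' 0 = 0 by rewrite /z' e1 subrr.
  have z0 : z 0 = 0 by rewrite /z e0 subrr.
  have := is_derive_0_is_cst
    (f := fun s : R => dotv (z' s) (z' s) + K * dotv (z s) (z s)) s 0.
  rewrite z'0 z0 !dotv0 mulr0 addr0; apply=> r.
  have H1 := is_derive_dotv (dz' r) (dz' r).
  have H2 := is_derive_dotv (dz r) (dz r).
  have [dE E'] := is_deriveD H1 (is_deriveZ K H2).
  apply: DeriveDef; first exact: dE.
  apply: etrans E' _; rewrite -[K *: (_ : R^o)]/(K * _).
  by rewrite dotvZl dotvZr (dotvC (z r)); ring.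
have z'0 s : z' s = 0.
  apply/eqP; rewrite -dotv_eq0; apply/eqP; have := energy s.
  have := mulr_ge0 (dotv_ge0 (derive1 gam1 0)) (dotv_ge0 (z s)).
  by have := dotv_ge0 (z' s); rewrite -/K; lra.
apply/eqP; rewrite -subr_eq0 -/(z t) -dotv_eq0.
have -> : dotv (z t) (z t) = dotv (z 0) (z 0).
  apply: (is_derive_dotv_cst dz dz) => s.
  by rewrite z'0 dotv0 dotvC dotv0 addr0.
by rewrite /z e0 subrr dotv0.
Qed.

(** The great circle shows that the default of [xget] is not reached, and uniqueness of geodesics
    identifies whichever geodesic [xget] selects with it. *)
Lemma riem_exp_sphere x u k : S x -> S u -> dotv x u = 0 ->
  riem_exp S (x, k *: u) = cos k *: x + sin k *: u.
Proof.
move=> Sx Su xu; have gc := geodesic_great_circle k Sx Su xu.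
rewrite /riem_exp; case: xgetP => /=
  [y _ [gam [gg g0 g1 <-]]|/(_ (great_circle x u k 1))[]].
  rewrite (geodesic_uniq gg gc) ?great_circle0//.
    by rewrite /great_circle mulr1.
  by rewrite derive1_great_circle great_circle0.
exists (great_circle x u k); split=> //; first exact: great_circle0.
by rewrite derive1_great_circle great_circle0.
Qed.

End SphereGeodesics.

(** * Nearest points of a cone and the reach of its trace on the sphere *)

Section NearestPoints.
Context {R : realType} {m : nat}.
Local Notation E := 'rV[R]_m.
Local Notation S := (@unit_sphere R m).
Implicit Types (C M : set E) (u v w x y z : E) (a : R).

Lemma reach_ge0 M : 0 <= reach S M.
Proof.
rewrite /reach; have [[[e Ee] ubE]|/sup_out->//] := pselect (has_sup [set eps | 0 <= eps /\
    diffeo_onto_image (normal_tube S M eps) (riem_exp S)]).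
by apply: le_trans Ee.1 _; exact: ub_le_sup.
Qed.

(** Some admissible radius exceeds [t], and on its tube the exponential map has a left inverse. The
    tube hypotheses range over all [eps > t] because that radius is known only through the
    supremum. *)
Lemma reach_inj M (t : R) v1 v2 y1 y2 : 0 <= t -> t < reach S M ->
  (forall eps, t < eps -> normal_tube S M eps (y1, v1)) ->
  (forall eps, t < eps -> normal_tube S M eps (y2, v2)) ->
  riem_exp S (y1, v1) = riem_exp S (y2, v2) -> y1 = y2.
Proof.
move=> t0 t_lt tube1 tube2 e12.
have hs : has_sup [set eps | 0 <= eps /\
    diffeo_onto_image (normal_tube S M eps) (riem_exp S)].
  (* Without a supremum, [sup] takes its default value 0, which contradicts [0 <= t < reach S M]. *)
  by apply: contrapT => /sup_out; rewrite -/(reach S M); lra.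
have [eps [_ [g [gK _ _]]]] := sup_gt hs.1 t_lt.
move=> t_eps; have := congr1 g e12.
by rewrite !gK; [case|exact: tube2|exact: tube1].
Qed.

Definition nearest C x z :=
  C z /\ forall y, C y -> enorm (x - z) <= enorm (x - y).

Lemma nearest_sqr C x z y : nearest C x z -> C y ->
  dotv (x - z) (x - z) <= dotv (x - y) (x - y).
Proof.
by move=> [_ zmin] /zmin; rewrite -!sqr_enorm ler_sqr ?nnegrE ?enorm_ge0.
Qed.

Section Cone.
Variable C : set E.
Hypothesis coneC : forall a z, C z -> C (a *: z).

Lemma cone_nearest_dotv x z : nearest C x z -> dotv x z = dotv z z.
Proof.
move=> zC; have [/eqP|zz0] := eqVneq (dotv z z) 0.
  by rewrite dotv_eq0 => /eqP->; rewrite !dotv0.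
(* [a *: z] is the orthogonal projection of [x] onto the line of [z]; comparing it with [z] yields
   $(a-1)^2|z|^2\le0$. *)
pose a := dotv x z / dotv z z.
have := nearest_sqr zC (coneC a zC.1).
have xz : dotv x z = a * dotv z z by rewrite /a divfK.
rewrite !dotvE (dotvC z x) xz => le_a.
have : (a - 1) ^+ 2 * dotv z z <= 0 by move: le_a; lra.
rewrite pmulr_lle0; last by rewrite lt_neqAle eq_sym zz0 dotv_ge0.
move=> a1; have /eqP : (a - 1) ^+ 2 == 0 by rewrite eq_le a1 sqr_ge0.
by move/eqP; rewrite sqrf_eq0 subr_eq0 => /eqP ->; rewrite mul1r.
Qed.

Lemma cone_nearest_pythagoras x z : nearest C x z ->
  enorm x ^+ 2 = enorm z ^+ 2 + enorm (x - z) ^+ 2.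
Proof.
move=> /cone_nearest_dotv xz; rewrite !sqr_enorm !dotvE (dotvC z x) xz; ring.
Qed.

(** Comparing [z] with the projection [dotv x y *: y] of [x], also in the cone, gives
    $|x|^2-|z|^2\le|x|^2-\langle x,y\rangle^2$. *)
Lemma cone_nearest_dotv_le x z y : nearest C x z -> C y -> S y ->
  dotv x y <= enorm z.
Proof.
move=> zC Cy /unit_sphereE yy; apply: le_trans (ler_norm _) _.
rewrite -ler_sqr ?nnegrE ?enorm_ge0// sqr_enorm real_normK ?num_real//.
have := nearest_sqr zC (coneC (dotv x y) Cy).
rewrite !dotvE (dotvC z x) (dotvC y x) yy (cone_nearest_dotv zC); lra.
Qed.

Lemma cone_nearest_normal_tube x z (t eps : R) : nearest C x z ->
  enorm z != 0 -> enorm (x - z) != 0 -> 0 <= t < eps ->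
  [/\ S ((enorm z)^-1 *: z), S ((enorm (x - z))^-1 *: (x - z)),
      dotv ((enorm z)^-1 *: z) ((enorm (x - z))^-1 *: (x - z)) = 0 &
      normal_tube S (C `&` S) eps
        ((enorm z)^-1 *: z, t *: ((enorm (x - z))^-1 *: (x - z)))].
Proof.
move=> zC z0 xz0 /andP[t0 teps].
have Sy := normalize_sphere z0; have Su := normalize_sphere xz0.
have Cy : C ((enorm z)^-1 *: z) by exact/coneC/zC.1.
have yu : dotv ((enorm z)^-1 *: z) ((enorm (x - z))^-1 *: (x - z)) = 0.
  rewrite dotvZl dotvZr dotvBr dotvC (cone_nearest_dotv zC) subrr.
  by rewrite !mulr0.
have xy : dotv x ((enorm z)^-1 *: z) = enorm z.
  by rewrite dotvZr (cone_nearest_dotv zC) -sqr_enorm expr2 mulKf.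
split=> //; split=> //=.
- by apply/tangent_sphereP => //; rewrite dotvZr yu mulr0.
- move=> w Mw.
  (* Both [x] and [z / |z|], as linear functionals, are maximal on the unit part of the cone at
     [z / |z|]; so tangent vectors there are orthogonal to [x] and [z], hence to [x - z]. *)
  have xw : dotv x w = 0.
    apply: (tangent_argmax_dotv Mw) => v [Cv Sv].
    by rewrite xy; exact: cone_nearest_dotv_le.
  have yw : dotv ((enorm z)^-1 *: z) w = 0.
    apply: (tangent_argmax_dotv Mw) => v [_ Sv].
    by move/unit_sphereE : (Sy) => ->; exact: dotv_unit_sphere.
  move/eqP : yw; rewrite dotvZl mulf_eq0 invr_eq0 (negPf z0)/= => /eqP zw.
  by rewrite !dotvZl dotvBl xw zw subrr !mulr0.
- by rewrite enormZ Su mulr1 ger0_norm.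
Qed.

(* With y = z / |z|, u = (x - z) / |x - z| and sin t = |x - z| / |x|, both nearest
   points z give exp_y(t u) = x / |x|, and t is below the reach. *)
Lemma cone_nearest_uniq x z1 z2 : nearest C x z1 -> nearest C x z2 ->
  enorm (x - z1) < sin (reach S (C `&` S)) * enorm x -> z1 = z2.
Proof.
move=> zC1 zC2 lt_x.
(* The two distances agree by minimality and the two norms by Pythagoras, so a single angle [t]
   serves both points. *)
have d12 : enorm (x - z2) = enorm (x - z1).
  by apply/eqP; rewrite eq_le (zC1.2 _ zC2.1) (zC2.2 _ zC1.1).
have r12 : enorm z2 = enorm z1.
  apply/eqP; rewrite -(@eqrXn2 _ 2)// ?enorm_ge0//; apply/eqP.
  have := cone_nearest_pythagoras zC1; have := cone_nearest_pythagoras zC2.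
  by rewrite d12; lra.
have dist0 z : enorm (x - z) = 0 -> x = z.
  by move=> /eqP; rewrite enorm_eq0 subr_eq0 => /eqP.
have [d0|d0] := eqVneq (enorm (x - z1)) 0.
  by rewrite -(dist0 _ d0); apply: dist0; rewrite d12.
have x0 : 0 < enorm x.
  rewrite lt_neqAle enorm_ge0 andbT; apply: contraTneq lt_x => <-.
  by rewrite mulr0 -leNgt enorm_ge0.
have d_ge0 := enorm_ge0 (x - z1).
have d_lt : enorm (x - z1) < enorm x.
  by apply: lt_le_trans lt_x _; rewrite ler_piMl ?sin_le1// ltW.
(* If [z1] were 0, Pythagoras would make its distance to [x] equal to [|x|], whereas a sine is at
   most 1 and the hypothesis is strict. *)
have r0 : enorm z1 != 0.
  apply: contraTneq d_lt => rz; have := cone_nearest_pythagoras zC1.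
  rewrite rz expr0n add0r => /eqP; rewrite eqrXn2 ?enorm_ge0// => /eqP ->.
  by rewrite ltxx.
pose s := enorm (x - z1) / enorm x.
have s01 : 0 <= s <= 1.
  by rewrite divr_ge0 ?enorm_ge0//= ler_pdivrMr// mul1r ltW.
have s11 : -1 <= s <= 1 by case/andP: s01 => ? ?; apply/andP; split; lra.
pose t := asin s.
have sin_t : sin t = s by rewrite asinK// in_itv.
have cos_t : cos t = enorm z1 / enorm x.
  rewrite cos_asin// -[RHS]ger0_norm ?divr_ge0 ?enorm_ge0// -sqrtr_sqr.
  congr Num.sqrt; rewrite /s !expr_div_n.
  have /(congr1 (fun c => c / enorm x ^+ 2)) := cone_nearest_pythagoras zC1.
  by rewrite divff ?expf_neq0 ?gt_eqF// mulrDl => ->; ring.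
have t_pihalf : t \in `[- (pi / 2), pi / 2].
  by rewrite in_itv/= asin_geNpi2 ?asin_lepi2.
have t0 : 0 <= t.
  have pi0 := pi_ge0 R.
  rewrite leNgt -ltr_sin//; last by rewrite in_itv/=; apply/andP; split; lra.
  by rewrite sin0 sin_t -leNgt; case/andP: s01.
(* Otherwise $0\le\rho\le t\le\pi/2$ for the reach $\rho$, and monotonicity of the sine there gives
   $\sin\rho\le\sin t=|x-z_1|/|x|$, against the hypothesis. *)
have t_lt : t < reach S (C `&` S).
  rewrite ltNge; apply/negP => rt.
  have reach0 := reach_ge0 (C `&` S).
  have pi0 := pi_ge0 R.
  move: lt_x; rewrite -ltr_pdivrMr// -/s -sin_t ltr_sin//; first by rewrite ltNge rt.
  by move: t_pihalf; rewrite !in_itv/= => /andP[? ?]; apply/andP; split; lra.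
have exp_x z : nearest C x z -> enorm z = enorm z1 ->
    enorm (x - z) = enorm (x - z1) ->
    riem_exp S ((enorm z)^-1 *: z, t *: ((enorm (x - z))^-1 *: (x - z)))
    = (enorm x)^-1 *: x.
  move=> zC rE dE.
  have [|||Sy Su yu _] := @cone_nearest_normal_tube x z t (t + 1) zC.
  - by rewrite rE.
  - by rewrite dE.
  - by rewrite t0 ltrDl ltr01.
  rewrite riem_exp_sphere// cos_t sin_t rE dE /s !scalerA.
  rewrite ![_ / enorm x]mulrC -!mulrA !divff// !mulr1 -scalerDr.
  by rewrite addrC subrK.
have tube z eps : nearest C x z -> enorm z = enorm z1 ->
    enorm (x - z) = enorm (x - z1) -> t < eps ->
    normal_tube S (C `&` S) eps
      ((enorm z)^-1 *: z, t *: ((enorm (x - z))^-1 *: (x - z))).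
  move=> zC rE dE teps.
  by have [|||//] := @cone_nearest_normal_tube x z t eps zC;
    rewrite ?rE ?dE ?t0.
have : (enorm z1)^-1 *: z1 = (enorm z2)^-1 *: z2.
  apply: (reach_inj t0 t_lt (fun eps => @tube z1 eps zC1 erefl erefl)
    (fun eps => @tube z2 eps zC2 r12 d12)).
  by rewrite !exp_x.
by rewrite r12 => /(scalerI _) -> //; rewrite invr_eq0.
Qed.

End Cone.
End NearestPoints.

(** * Bombieri-Weyl coordinates and powers of linear forms *)

Section BombieriWeyl.
Context {R : realType} {n d : nat}.
Local Notation form := (dhomog n.+1 R d).
Implicit Types (p q : form) (a : 'rV[R]_n.+1) (c : R).

Lemma bw_coordB p q : bw_coord (p - q) = bw_coord p - bw_coord q.
Proof. by apply/rowP => i; rewrite !mxE !raddfB/= mulrBl. Qed.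

Lemma bw_coordZ c p : bw_coord (c *: p) = c *: bw_coord p.
Proof. by apply/rowP => i; rewrite !mxE [mpoly_of_dhomog _]linearZ/= mcoeffZ mulrA. Qed.

Lemma multinomial_coef_gt0 (m : multinom n.+1) : 0 < multinomial_coef (R := R) m.
Proof.
rewrite divr_gt0 ?ltr0n ?fact_gt0//.
by apply: prodr_gt0 => i _; rewrite ltr0n fact_gt0.
Qed.

Lemma bw_coord_mcoeff p m : mdeg m = d ->
  exists i, mcoeff m p = bw_coord p 0 i * Num.sqrt (multinomial_coef m).
Proof.
move=> dm; have mm : m \in @monomials n d by rewrite -basis_cover dm.
have := mm; rewrite -index_mem size_basis => lt_m.
exists (Ordinal lt_m); rewrite mxE /= nth_index// divfK//.
by rewrite gt_eqF// sqrtr_gt0 multinomial_coef_gt0.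
Qed.

Lemma dhomog_eqP e (f g : dhomog n.+1 R e) :
  (forall m, mdeg m = e -> mcoeff m f = mcoeff m g) -> f = g.
Proof.
move=> fg; apply/val_inj/mpolyP => m; have [/fg//|me] := eqVneq (mdeg m) e.
by rewrite !(dhomog_nemf_coeff (dhomog_is_dhomog _) me).
Qed.

Lemma bw_coord_inj : injective (@bw_coord R n d).
Proof.
move=> p q pq; apply: dhomog_eqP => m dm; apply/eqP; rewrite -subr_eq0.
rewrite -mcoeffB -raddfB/=; have [i ->] := bw_coord_mcoeff (p - q) dm.
by rewrite bw_coordB pq subrr mxE mul0r.
Qed.

(** Homogeneity of $x_i$ in degree 1, spelled out without notation as the proof that [DHomog]
    takes. *)
Lemma var_homog (i : 'I_n.+1) :
  in_mem (mpolyX R (mnm1 i))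
    (mem (has_quality 0 (ishomog1 (R := R) 1 (@mdeg n.+1)))).
Proof. by rewrite dhomogX; apply/eqP; exact: mdeg1. Qed.

Definition var_form i : dhomog n.+1 R 1 := DHomog (var_homog i).

Definition linear_form a : dhomog n.+1 R 1 := \sum_i a 0 i *: var_form i.

Lemma mpoly_linear_form a :
  mpoly_of_dhomog (linear_form a) = \sum_i a 0 i *: mpolyX R (mnm1 i).
Proof. by rewrite raddf_sum. Qed.

Lemma linear_formP (l : dhomog n.+1 R 1) : exists a, l = linear_form a.
Proof.
exists (\row_i mcoeff (mnm1 i) l); apply: dhomog_eqP => m /eqP/mdeg1P[i /eqP->].
rewrite mpoly_linear_form raddf_sum (bigD1 i)//= big1 => [|j ji].
  by rewrite mcoeffZ mcoeffX eqxx mulr1 mxE addr0.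
by rewrite mcoeffZ mcoeffX eq_mnm1 (negPf ji) mulr0.
Qed.

Lemma power_homog (l : dhomog n.+1 R 1) :
  in_mem (mpoly_of_dhomog l ^+ d)
    (mem (has_quality 0 (ishomog1 (R := R) d (@mdeg n.+1)))).
Proof. by have := dhomogMn d (dhomog_is_dhomog l); rewrite mul1n. Qed.

Definition power_form (l : dhomog n.+1 R 1) : form := DHomog (power_homog l).

(** By induction on [k]: the coefficients of a product are finite sums of products of coefficients,
    and those of a linear form are linear in [a]. *)
Lemma continuous_mcoeff_power k (m : multinom n.+1) :
  continuous (fun a => mcoeff m (mpoly_of_dhomog (linear_form a) ^+ k)).
Proof.
have sumC (I : Type) (r : seq I) (P : pred I) (F : I -> 'rV[R]_n.+1 -> R) :
    (forall i, P i -> continuous (F i)) ->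
    continuous (fun a => \sum_(i <- r | P i) F i a).
  move=> cF; apply: continuous_big => //; exact: add_continuous.
have clin m' : continuous (fun a => mcoeff m' (mpoly_of_dhomog (linear_form a))).
  under eq_fun do rewrite mpoly_linear_form raddf_sum/=.
  apply: sumC => j _; under eq_fun do rewrite mcoeffZ.
  move=> b; apply: continuousM; last exact: cst_continuous.
  exact: coord_continuous.
elim: k m => [|k IHk] m.
  by under eq_fun do rewrite expr0; exact: cst_continuous.
under eq_fun do rewrite exprS mcoeffM; apply: sumC => i _ a.
by apply: continuousM; [exact: clin|exact: IHk].
Qed.

Lemma mcoeff_power_form a (i : 'I_n.+1) :
  mcoeff (mnm_muln (mnm1 i) d) (power_form (linear_form a)) = a 0 i ^+ d.
Proof.
(* Evaluation at the [i]-th unit vector sends the linear form to [a 0 i], and among the monomials of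
   degree [d] it keeps only $x_i^d$. *)
have <- : meval (fun j => (j == i)%:R) (power_form (linear_form a)) = a 0 i ^+ d.
  rewrite /= rmorphXn mpoly_linear_form raddf_sum (bigD1 i)//= big1 => [|j ji].
    by rewrite mevalZ mevalXU eqxx mulr1 addr0.
  by rewrite mevalZ mevalXU (negPf ji) mulr0.
set q := power_form _; rewrite mevalE.
have msupp_deg m : m \in msupp q -> mdeg m = d.
  exact: (dhomog_mf (dhomog_is_dhomog q)).
have evalX m : m \in msupp q ->
    \prod_j ((j == i)%:R : R) ^+ m j = (m == mnm_muln (mnm1 i) d)%:R.
  move=> /msupp_deg dm; have [->|mi] := eqVneq m (mnm_muln (mnm1 i) d).
    rewrite big1// => j _; rewrite mulmnE mnm1E eq_sym.
    by case: eqP => _; rewrite ?expr1n// mul0n expr0.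
  have [j ji mj] : exists2 j, j != i & m j != 0%N.
    apply: contrapT => mE; case/eqP: mi.
    have m0 j : j != i -> m j = 0%N.
      by move=> ji; apply/eqP; apply: contrapT => /negP mj; apply: mE; exists j.
    apply/mnmP => j; rewrite mulmnE mnm1E eq_sym; have [->|/m0//] := eqVneq j i.
    by rewrite mul1n -dm mdegE (bigD1 i)//= big1 ?addn0.
  by rewrite (bigD1 j)//= (negPf ji) expr0n (negPf mj) mul0r.
have [qi|qi] := boolP (mnm_muln (mnm1 i) d \in msupp q).
  rewrite (bigD1_seq _ qi (msupp_uniq _))//= evalX// eqxx mulr1.
  rewrite big_seq_cond big1 ?addr0// => m /andP[mq mi].
  by rewrite evalX// (negPf mi) mulr0.
rewrite (memN_msupp_eq0 qi) big_seq big1// => m mq; rewrite evalX//.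
by case: eqP => [mi|_]; [rewrite -mi mq in qi|rewrite mulr0].
Qed.

(** Since $x_i^d$ has multinomial coefficient 1, its coefficient is itself a Bombieri-Weyl
    coordinate, bounded by the norm. The reverse triangle inequality then gives coercivity in
    [a]. *)
Lemma coord_power_le_bw_norm a (i : 'I_n.+1) p c : `|c| = 1 ->
  `|a 0 i| ^+ d - bw_norm p <= bw_norm (p - c *: power_form (linear_form a)).
Proof.
move=> c1; have dm : mdeg (mnm_muln (mnm1 i) d) = d by rewrite mdegMn mdeg1 mul1n.
have m1 : multinomial_coef (mnm_muln (mnm1 i) d) = 1 :> R.
  rewrite /multinomial_coef dm (bigD1 i)//= big1 => [|j ji].
    by rewrite mulmnE mnm1E eqxx mul1n mulr1 divff// pnatr_eq0 -lt0n fact_gt0.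
  by rewrite mulmnE mnm1E eq_sym (negPf ji) mul0n fact0.
have coef_le (q : form) : `|mcoeff (mnm_muln (mnm1 i) d) q| <= bw_norm q.
  have [j ->] := bw_coord_mcoeff q dm.
  by rewrite m1 sqrtr1 mulr1; exact: coord_le_enorm.
have := coef_le (p - c *: power_form (linear_form a)); apply: le_trans.
rewrite !raddfB/= mcoeffZ.
rewrite -[mpoly_of_dhomog _ ^+ d]/(mpoly_of_dhomog (power_form (linear_form a))).
rewrite mcoeff_power_form distrC; apply: le_trans (lerB_dist _ _).
by rewrite normrM c1 mul1r normrX lerB// coef_le.
Qed.

Lemma continuous_bw_norm_power p c :
  continuous (fun a => bw_norm (p - c *: power_form (linear_form a))).
Proof.
move=> a; rewrite /bw_norm.
apply: (@continuous_comp _ _ _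
  (fun b => bw_dot (p - c *: power_form (linear_form b))
                   (p - c *: power_form (linear_form b))) Num.sqrt);
  last exact: sqrt_continuous.
move: a; apply: continuous_big; first exact: add_continuous.
move=> i _.
pose g a := bw_coord (power_form (linear_form a)) 0 i.
have cont_g : continuous g.
  pose mi := nth mnm0 (@monomials n d) i.
  have -> : g = (fun a => mcoeff mi (mpoly_of_dhomog (linear_form a) ^+ d))
      \* cst (Num.sqrt (multinomial_coef mi))^-1.
    by apply/funext => a; rewrite /g mxE.
  move=> a; apply: continuousM; last exact: cst_continuous.
  exact: continuous_mcoeff_power.
have cont_coord : continuous (fun a =>
    bw_coord (p - c *: power_form (linear_form a)) 0 i).
  have -> : (fun a => bw_coord (p - c *: power_form (linear_form a)) 0 i)
      = cst (bw_coord p 0 i) - cst c \* g.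
    by apply/funext => a; rewrite bw_coordB bw_coordZ; rewrite [LHS]mxE; congr (_ + _);
      rewrite [LHS]mxE; congr (- _); rewrite [LHS]mxE.
  move=> a; apply: (@continuousB R R^o); first exact: cst_continuous.
  by apply: continuousM; [exact: cst_continuous|exact: cont_g].
by move=> a; apply: continuousM; exact: cont_coord.
Qed.

End BombieriWeyl.

(** * Existence of best rank-one approximations and the cone structure *)

Section BestRankOne.
Context {R : realType} {n d : nat}.
Hypothesis d_gt0 : (0 < d)%N.
Local Notation form := (dhomog n.+1 R d).
Implicit Types (p q : form) (a : 'rV[R]_n.+1) (c : R).

Lemma power_form_argmin p c : `|c| = 1 -> exists a, forall b,
  bw_norm (p - c *: power_form (linear_form a))
    <= bw_norm (p - c *: power_form (linear_form b)).
Proof.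
move=> c1; pose F a := bw_norm (p - c *: power_form (linear_form a)).
(* The summand 1 ensures $|b_i|\le|b_i|^d$ once $|b_i|>B$; then $|b_i|^d-\|p\|$ exceeds $\|p\|$, the
   value at 0. So a minimum over the box [K] is global. *)
pose B := 1 + 2 * bw_norm p.
have p0 : 0 <= bw_norm p by exact: enorm_ge0.
pose K : set 'rV[R]_n.+1 := [set a | forall i, `[- B, B]%classic (a 0 i)].
have K0 : K 0 by move=> i; rewrite /= mxE in_itv/= /B; apply/andP; split; lra.
have cK : compact K.
  apply: (@rV_compact _ _ (fun=> `[- B, B]%classic)) => _.
  exact: segment_compact.
have [||a _ amin] := @compact_EVT_min _ _ F K _ cK; first by exists 0.
  by apply: continuous_subspaceT => a; exact: continuous_bw_norm_power.
exists a => b; have [Kb|/existsNP[i Kb]] := pselect (K b).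
  by apply: amin; rewrite inE.
have F0 : F 0 = bw_norm p.
  rewrite /F; congr bw_norm; suff -> : power_form (linear_form 0) = 0 :> form.
    by rewrite scaler0 subr0.
  apply: val_inj => /=; rewrite mpoly_linear_form big1 => [|j _].
    by rewrite expr0n gtn_eqF.
  by rewrite mxE scale0r.
apply: (@le_trans _ _ (F 0)); first by apply: amin; rewrite inE.
have B_lt : B < `|b 0 i|.
  rewrite ltNge; apply/negP; rewrite ler_norml => ?; apply: Kb.
  by rewrite /= in_itv.
apply: le_trans (coord_power_le_bw_norm b i p c1); rewrite F0.
have : `|b 0 i| <= `|b 0 i| ^+ d.
  by rewrite ler_eXnr//; move: B_lt; rewrite /B; lra.
by move: B_lt; rewrite /B; lra.
Qed.

Lemma veroneseP q : veronese R n d q <->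
  exists2 c, c = 1 \/ c = -1 & exists a, q = c *: power_form (linear_form a).
Proof.
split=> [[l lq]|[c c1 [a ->]]].
  have [a la] := linear_formP l; subst l.
  case: lq => lq; [exists 1; first by left|exists (-1); first by right];
    exists a; apply: val_inj; rewrite /= lq.
    by rewrite scale1r.
  by rewrite scaleN1r.
exists (linear_form a); case: c1 => ->; [left|right].
  by rewrite scale1r.
by rewrite scaleN1r.
Qed.

(** Minimize separately over the two sign branches $\ell^d$ and $-\ell^d$, and keep the better
    minimizer. *)
Lemma veronese_argmin p : exists2 q, veronese R n d q &
  forall q', veronese R n d q' -> bw_norm (p - q) <= bw_norm (p - q').
Proof.
have [a amin] := @power_form_argmin p 1 (normr1 _).
have [b bmin] := @power_form_argmin p (-1) (normrN1 _).
have [ab|ba] := leP (bw_norm (p - 1 *: power_form (linear_form a)))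
    (bw_norm (p - (-1) *: power_form (linear_form b))).
  exists (1 *: power_form (linear_form a)).
    by apply/veroneseP; exists 1; [left|exists a].
  move=> _ /veroneseP[c [->|->] [e ->]]; first exact: amin.
  exact: le_trans ab (bmin _).
exists ((-1) *: power_form (linear_form b)).
  by apply/veroneseP; exists (-1); [right|exists b].
move=> _ /veroneseP[c [->|->] [e ->]]; last exact: bmin.
exact: le_trans (ltW ba) (amin _).
Qed.

Lemma veroneseZ c q : veronese R n d q -> veronese R n d (c *: q).
Proof.
(* The [d]-th root of [|c|] is absorbed into the linear form; the sign of [c] either keeps or
   exchanges the two branches. *)
move=> [l lq]; pose r := `|c| `^ d%:R^-1.
have rd : r ^+ d = `|c|.
  by rewrite -powR_mulrn ?powR_ge0// -powRrM mulVf ?pnatr_eq0 ?gtn_eqF// powRr1.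
exists (r *: l); rewrite /= exprZn rd.
case: lq => ->; have [c0|/ltW c0] := leP 0 c;
  rewrite ?(ger0_norm c0) ?(ler0_norm c0) ?scalerN ?scaleNr ?opprK.
all: by [left|right].
Qed.

Lemma bw_dist_min p q : veronese R n d q ->
  (forall q', veronese R n d q' -> bw_norm (p - q) <= bw_norm (p - q')) ->
  bw_dist p (veronese R n d) = bw_norm (p - q).
Proof.
move=> Vq qmin; apply/eqP; rewrite eq_le; apply/andP; split.
  apply: ge_inf; last by exists q.
  by exists 0 => _ [q' _ <-]; exact: enorm_ge0.
apply: lb_le_inf; first by exists (bw_norm (p - q)), q.
by move=> _ [q' Vq' <-]; exact: qmin.
Qed.

(** An attained minimum turns the infimum into a comparison with every element of the cone;
    injectivity of [bw_coord] recovers [q] from its coordinates. *)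
Lemma best_rank_oneP p q :
  best_rank_one p q <->
  nearest (bw_coord @` veronese R n d) (bw_coord p) (bw_coord q).
Proof.
have [q0 Vq0 q0min] := veronese_argmin p.
rewrite /best_rank_one (bw_dist_min Vq0 q0min) /nearest.
split=> [[Vq qE]|[[q1 Vq1 /bw_coord_inj <-] qmin]].
  split; first by exists q.
  move=> _ [q' Vq' <-]; rewrite -!bw_coordB.
  by have := q0min _ Vq'; rewrite -qE.
split=> //; apply/eqP; rewrite eq_le q0min// andbT.
by have := qmin _ (imageP _ Vq0); rewrite -!bw_coordB.
Qed.

End BestRankOne.

Theorem corollary2 (R : realType) (n d : nat) (hn : (1 <= n)%N) (hd : (2 <= d)%N)
    (p : dhomog n.+1 R d)
    (hp : bw_dist p (veronese R n d)
            < sin (reach unit_sphere (veronese_sphere R n d)) * bw_norm p) :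
  exists! q : dhomog n.+1 R d, best_rank_one p q.
Proof.
have d_gt0 : (0 < d)%N by exact: ltnW.
have [q Vq qmin] := veronese_argmin d_gt0 p.
have pq : best_rank_one p q by split; rewrite ?(bw_dist_min Vq qmin).
exists q; split=> // q' pq'.
(* By definition [veronese_sphere] is the intersection of this cone with the unit sphere, so the
   reach in the hypothesis is the one required. *)
apply: bw_coord_inj; apply: (@cone_nearest_uniq _ _ (bw_coord @` veronese R n d)).
- by move=> c _ [r Vr <-]; exists (c *: r); [exact: veroneseZ|exact: bw_coordZ].
- by move/best_rank_oneP : pq; exact.
- by move/best_rank_oneP : pq'; exact.
- by rewrite -bw_coordB; rewrite (bw_dist_min Vq qmin) in hp.
Qed.
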